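(* Let $d\ge 1$, let $f$ be one of the densities $f_{\mathrm p},f_{\mathrm e},f_{\mathrm g}$ on $\mathbb{R}^d$ given by $$f_{\mathrm p}(x)=\frac{c_{\mathrm p}}{1+\|x\|^\alpha}\ (\alpha>d),\qquad f_{\mathrm e}(x)=c_{\mathrm e}e^{-\|x\|},\qquad f_{\mathrm g}(x)=c_{\mathrm g}e^{-\|x\|^2/2},$$ and let $\mathcal{X}_n=\{X_1,\dots,X_n\}$ be i.i.d. samples from $f$. Let $\{R_n\}_{n\ge1}$ be an increasing sequence of positive numbers and let $C_n$ be the event $$C_n=\Big\{B_{R_n}(0)\subset \bigcup_{X\in\mathcal{X}_n\cap B_{R_n}(0)}B_1(X)\Big\}.$$ Let $\epsilon>0$ and define $$R_n^{\mathrm c}=\begin{cases}\Big(\dfrac{\delta_{\mathrm p}\,n}{\log n-e^{-\epsilon}\log\log n}-1\Big)^{1/\alpha}& f=f_{\mathrm p},\\[2mm] \log n-\log\log\log n-\delta_{\mathrm e}-\epsilon & f=f_{\mathrm e},\\[1mm] \sqrt{2\big(\log n-\log\log\log n-\delta_{\mathrm g}-\epsilon\big)} & f=f_{\mathrm g},\end{cases}$$ where $$\delta_{\mathrm p}=c_{\mathrm p}\,\alpha\,2^{-d}d^{-(1+d/2)},\quad \delta_{\mathrm e}=(1+d/2)\log d+d\log 2-\log c_{\mathrm e},\quad \delta_{\mathrm g}=(1+d/2)\log d+(d-1)\log 2-\log c_{\mathrm g}.$$ If $R_n\le R_n^{\mathrm c}$ for all sufficiently large $n$, then $\mathbb{P}(C_n)\to1$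 as $n\to\infty$.
   Context: $\|\cdot\|$ is the Euclidean norm on $\mathbb{R}^d$; $B_r(x)$ is the closed Euclidean ball of radius $r$ centered at $x$. The positive constants $c_{\mathrm p},c_{\mathrm e},c_{\mathrm g}$ are the normalization constants making $f_{\mathrm p},f_{\mathrm e},f_{\mathrm g}$ probability densities. *)

(* Defs.v *)
From HB Require Import structures.
From mathcomp Require Import all_boot all_order all_algebra.
From mathcomp Require Import all_classical all_reals all_analysis.

Set Implicit Arguments.
Unset Strict Implicit.
Unset Printing Implicit Defensive.

Import Order.TTheory GRing.Theory Num.Theory.
Import numFieldNormedType.Exports.

Local Open Scope classical_set_scope.
Local Open Scope ring_scope.

(* R^d is [d.-tuple R], whose library sigma-algebra is generated by the
   coordinate projections, i.e. the Borel sigma-algebra. (The library puts the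
   sup norm on ['rV[R]_d] and no sigma-algebra, hence the tuples and the
   Euclidean distance below.) *)

Section euclidean.
Context {R : realType} {d : nat}.
Implicit Types x y : d.-tuple R.

Definition eucl_norm x : R := Num.sqrt (\sum_(i < d) tnth x i ^+ 2).

Definition eucl_dist x y : R :=
  Num.sqrt (\sum_(i < d) (tnth x i - tnth y i) ^+ 2).

Definition origin : d.-tuple R := [tuple 0 | i < d].

Definition eucl_ball x (r : R) : set (d.-tuple R) :=
  [set y | eucl_dist x y <= r].

End euclidean.

Section lebesgue_tuple.
Context {R : realType}.
Local Open Scope ereal_scope.

Definition tcons n (p : R * n.-tuple R) : n.+1.-tuple R := cons_tuple p.1 p.2.

Lemma measurable_tcons n : measurable_fun [set: R * n.-tuple R] (@tcons n).
Proof. by apply: measurable_cons. Qed.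

Definition tuncons n (t : n.+1.-tuple R) : R * n.-tuple R :=
  (thead t, [tuple of behead t]).

Lemma tconsK n : cancel (@tcons n) (@tuncons n).
Proof. by case=> a t; rewrite /tuncons theadE; congr pair; apply/val_inj. Qed.

Lemma measurable_tuncons n : measurable_fun [set: n.+1.-tuple R] (@tuncons n).
Proof.
apply/measurable_fun_pairP; split; first exact: measurable_tnth.
exact: measurable_behead.
Qed.

Section step.
Variables (n : nat) (m : {sigma_finite_measure set (n.-tuple R) -> \bar R}).

Definition lebesgue_step : set (n.+1.-tuple R) -> \bar R :=
  pushforward (@lebesgue_measure R \x m) (@tcons n).

Let step0 : lebesgue_step set0 = 0.
Proof. by rewrite /lebesgue_step /pushforward preimage_set0 measure0. Qed.

Let step_ge0 A : 0 <= lebesgue_step A.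
Proof. by rewrite /lebesgue_step /pushforward; exact: measure_ge0. Qed.

Let step_sigma_additive : semi_sigma_additive lebesgue_step.
Proof.
have mc B : measurable B -> measurable (@tcons n @^-1` B).
  by move=> mB; rewrite -[X in measurable X]setTI; exact: measurable_tcons.
move=> F mF tF mUF; rewrite /lebesgue_step /pushforward preimage_bigcup.
apply: measure_semi_sigma_additive.
- by move=> k; exact: mc.
- apply/trivIsetP => /= i j _ _ ij; rewrite -preimage_setI.
  by move/trivIsetP : tF => /(_ _ _ _ _ ij) ->//; rewrite preimage_set0.
- by rewrite -preimage_bigcup; exact: mc.
Qed.

HB.instance Definition _ := isMeasure.Build _ _ _ lebesgue_step
  step0 step_ge0 step_sigma_additive.

Let step_sigma_finite : sigma_finite setT lebesgue_step.
Proof.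
have /sigma_finiteP[F [TF ndF Foo]] := sigma_finiteT (@lebesgue_measure R).
have /sigma_finiteP[G [TG ndG Goo]] := sigma_finiteT m.
exists (fun k => @tuncons n @^-1` (F k `*` G k)).
  apply/esym; rewrite -subTset => t _.
  have : [set: R] (thead t) by [].
  rewrite TF => -[i _ Fi].
  have : [set: n.-tuple R] [tuple of behead t] by [].
  rewrite TG => -[j _ Gj].
  exists (maxn i j) => //; split.
  - by move: Fi; apply/subsetPset/ndF/leq_maxl.
  - by move: Gj; apply/subsetPset/ndG/leq_maxr.
move=> k; have [mF Fk] := Foo k; have [mG Gk] := Goo k; split.
  rewrite -[X in measurable X]setTI; apply: measurable_tuncons => //.
  exact: measurableX.
rewrite /lebesgue_step /pushforward -comp_preimage.
rewrite (_ : @tuncons n \o @tcons n = id); last first.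
  by apply/funext => p /=; rewrite tconsK.
by rewrite preimage_id product_measure1E// lte_mul_pinfty// ge0_fin_numE.
Qed.

HB.instance Definition _ :=
  Measure_isSigmaFinite.Build _ _ _ lebesgue_step step_sigma_finite.

End step.

(* n-dimensional Lebesgue measure: iterated product of the one on R,
   transported along R * R^n ~ R^(n+1) *)
Fixpoint lebesgue_tuple n : {sigma_finite_measure set (n.-tuple R) -> \bar R} :=
  match n with
  | 0%N => \d_[tuple]
  | n.+1 => lebesgue_step (lebesgue_tuple n)
  end.

Lemma lebesgue_tuple_box n (A : 'I_n -> set R) :
  (forall i, measurable (A i)) ->
  lebesgue_tuple n [set x | forall i, A i (tnth x i)] =
    \prod_(i < n) lebesgue_measure (A i).
Proof.
elim: n A => [|n IH] A mA.
  rewrite big_ord0 /= (_ : [set x | _] = setT) ?diracT//.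
  by apply/seteqP; split => // x _ [].
rewrite big_ord_recl -(IH (fun i => A (lift ord0 i)))//.
rewrite [LHS]/= /lebesgue_step /pushforward.
rewrite (_ : _ @^-1` _ =
    A ord0 `*` [set x | forall i, A (lift ord0 i) (tnth x i)]); last first.
  apply/seteqP; split => -[a t] /=.
    move=> h; split; first exact: (h ord0).
    by move=> i; have := h (lift ord0 i); rewrite /tcons/= tnthS.
  move=> [h0 h] i; case: (unliftP ord0 i) => [j|] ->//.
  by rewrite /tcons/= tnthS; exact: h.
have mbox : measurable [set x : n.-tuple R |
    forall i, A (lift ord0 i) (tnth x i)].
  rewrite (_ : [set x | _] =
      \big[setI/setT]_(i < n) ((@tnth n R)^~ i @^-1` A (lift ord0 i))).
    apply: bigsetI_measurable => i _; rewrite -[X in measurable X]setTI.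
    exact: measurable_tnth.
  apply/seteqP; split => x /=; rewrite -bigcap_seq => h i.
    by move=> _; exact: h.
  by apply: (h i) => /=; exact: mem_index_enum.
rewrite product_measure1E//; exact: mA.
Qed.

End lebesgue_tuple.
Arguments lebesgue_tuple {R} n.

Inductive density_family (R : Type) : Type :=
  | PowerLaw of R
  | Exponential
  | Gaussian.
Arguments Exponential {R}.
Arguments Gaussian {R}.

Section models.
Context {R : realType}.
Implicit Types (fam : density_family R) (c : R).

Definition admissible_family (d : nat) fam : Prop :=
  if fam is PowerLaw alpha then d%:R < alpha else True.

(* [c] stands for the normalization constant of the chosen family. *)
Definition model_density (d : nat) fam c (x : d.-tuple R) : R :=
  match fam with
  | PowerLaw alpha => c / (1 + eucl_norm x `^ alpha)
  | Exponential => c * expR (- eucl_norm x)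
  | Gaussian => c * expR (- (eucl_norm x ^+ 2 / 2))
  end.

Definition normalization_constant (d : nat) fam c : Prop :=
  0 < c /\ (\int[lebesgue_tuple d]_x (model_density fam c x)%:E = 1)%E.

Definition delta (d : nat) fam c : R :=
  match fam with
  | PowerLaw alpha => c * alpha * 2 ^- d * d%:R `^ (- (1 + d%:R / 2))
  | Exponential => (1 + d%:R / 2) * ln d%:R + d%:R * ln 2 - ln c
  | Gaussian => (1 + d%:R / 2) * ln d%:R + (d%:R - 1) * ln 2 - ln c
  end.

(* Meaningful for [n] large only: for small [n] the iterated logarithms, the
   root and the real power take the library's default values. *)
Definition critical_radius (d : nat) fam c (eps : R) (n : nat) : R :=
  let ln1 := ln n%:R in
  let ln2 := ln ln1 in
  let ln3 := ln ln2 in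
  match fam with
  | PowerLaw alpha =>
      (delta d fam c * n%:R / (ln1 - expR (- eps) * ln2) - 1) `^ alpha^-1
  | Exponential => ln1 - ln3 - delta d fam c - eps
  | Gaussian => Num.sqrt (2 * (ln1 - ln3 - delta d fam c - eps))
  end.

End models.

Section sampling.
Context {R : realType} {disp : measure_display} {T : measurableType disp}.
Context {P : probability T R} {d : nat}.
Implicit Types (X : nat -> {RV P >-> d.-tuple R}) (f : d.-tuple R -> R).

Definition mutually_independent X : Prop :=
  forall (I : seq nat) (A : nat -> set (d.-tuple R)),
    uniq I -> (forall i, measurable (A i)) ->
    P (\big[setI/setT]_(i <- I) (X i @^-1` A i)) =
      (\prod_(i <- I) P (X i @^-1` A i))%E.

Definition has_density (Y : {RV P >-> d.-tuple R}) f : Prop :=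
  forall A : set (d.-tuple R), measurable A ->
    distribution P Y A = (\int[lebesgue_tuple d]_(x in A) (f x)%:E)%E.

Definition iid_from X f : Prop :=
  mutually_independent X /\ forall i, has_density (X i) f.

(* Samples are numbered from 0: the points X_1, ..., X_n are
   [X 0 w, ..., X n.-1 w]. *)
Definition sample X (n : nat) (w : T) : set (d.-tuple R) :=
  [set X i w | i in `I_n].

Definition cover_event X (n : nat) (r : R) : set T :=
  [set w | eucl_ball origin r `<=`
    \bigcup_(x in sample X n w `&` eucl_ball origin r) eucl_ball x 1].

End sampling.

(* Main.v *)
Require Import Defs.
From HB Require Import structures.
From mathcomp Require Import all_boot all_order all_algebra.
From mathcomp Require Import all_classical all_reals all_analysis.
From mathcomp Require Import measurable_realfun.
From mathcomp Require Import ring lra.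

Set Implicit Arguments.
Unset Strict Implicit.
Unset Printing Implicit Defensive.

Import Order.TTheory GRing.Theory Num.Theory.
Import numFieldNormedType.Exports.

Local Open Scope classical_set_scope.
Local Open Scope ring_scope.

(** Why coverage holds. Cut the space into cubes of side [1 / (2 sqrt d)], whose
diameter is [1/2]. A point [y] of the ball of radius [r >= 1/2] lies within [1/2]
of the point [(1 - 1/(2r)) y] of the concentric ball of radius [r - 1/2], hence a
grid cube containing the latter stays in the ball of radius [r] and within
distance [1] of [y] ([large_ball_grid]). So the event can only fail when some
cube contained in the ball receives none of the [n] sample points.

Every such cube carries mass at least [m g^d], where [g] is the side and [m] the
value of the radial density at the critical radius; the union bound then gives
[uncovered_probability_le]: failure has probability at most (number of
cubes) [* exp (- n m g^d)]. The constants [delta] are calibrated so that, with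
[L = ln n] and [l = ln L], the exponent [n m g^d] equals
[(d / alpha) (L - exp (- eps) l)], [d (exp eps) l] or [(d / 2) (exp eps) l] for
the power law, the exponential and the Gaussian density, whereas the number of
cubes is of order [(n / L)^(d / alpha)], [L^d] and [L^(d / 2)]. In each case the
product is at most a constant times [exp (- k l)] with [k > 0], and it vanishes.

A sequence of radii below the critical one may also stay below [1/2], where no
grid cube need fit. There a single sample point in the ball covers it, and since
the radii increase, a fixed cube inside the first ball is available; the
probability of missing it decays geometrically ([uncovered_probability_small]).

Finally, the probability of the coverage event is only meaningful because the
event is measurable: an uncovered point may be taken rational
([measurable_cover_event]). *)

(** * Euclidean geometry of tuples *)

(** With [s] and [t] the two norms, [sum (t a_i - s b_i)^2 >= 0] expands to
[2 s t (s t - sum a_i b_i)]; the factor [2 s t] can be cancelled unless one of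
the families vanishes. *)
Lemma cauchy_schwarz_sum {R : rcfType} {I : finType} (a b : I -> R) :
  \sum_i a i * b i <= Num.sqrt (\sum_i a i ^+ 2) * Num.sqrt (\sum_i b i ^+ 2).
Proof.
set A := \sum_i a i ^+ 2; set B := \sum_i b i ^+ 2.
have A0 : 0 <= A by apply: sumr_ge0 => i _; exact: sqr_ge0.
have B0 : 0 <= B by apply: sumr_ge0 => i _; exact: sqr_ge0.
set s := Num.sqrt A; set t := Num.sqrt B.
have s0 : 0 <= s by exact: sqrtr_ge0.
have t0 : 0 <= t by exact: sqrtr_ge0.
have sA : s ^+ 2 = A by rewrite sqr_sqrtr.
have tB : t ^+ 2 = B by rewrite sqr_sqrtr.
have null (u v : I -> R) : \sum_i u i ^+ 2 = 0 -> \sum_i u i * v i = 0.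
  move=> /eqP; rewrite psumr_eq0 => [/allP u0|i _]; last exact: sqr_ge0.
  apply: big1 => i _; have := u0 i (mem_index_enum i).
  by rewrite /= expf_eq0/= => /eqP ->; rewrite mul0r.
have [s00|sn0] := eqVneq s 0.
  by rewrite null ?s00 ?mul0r// -/A -sA s00 expr0n.
have [t00|tn0] := eqVneq t 0.
  under eq_bigr do rewrite mulrC.
  by rewrite null ?t00 ?mulr0// -/B -tB t00 expr0n.
have : 0 <= \sum_i (t * a i - s * b i) ^+ 2.
  by apply: sumr_ge0 => i _; exact: sqr_ge0.
have -> : \sum_i (t * a i - s * b i) ^+ 2 =
    t ^+ 2 * A + s ^+ 2 * B - 2 * (s * t) * \sum_i a i * b i.
  rewrite /A /B !big_distrr/= -sumrN -!big_split/=.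
  by apply: eq_bigr => i _; ring.
rewrite -sA -tB.
have st0 : 0 < s * t by rewrite mulr_gt0 ?lt0r ?s0 ?t0 ?sn0 ?tn0.
set C := \sum_i _; rewrite (_ : _ - _ = 2 * (s * t) * (s * t - C)); last ring.
by rewrite pmulr_rge0 ?subr_ge0// mulr_gt0.
Qed.

Lemma minkowski_sum {R : rcfType} {I : finType} (a b : I -> R) :
  Num.sqrt (\sum_i (a i + b i) ^+ 2) <=
  Num.sqrt (\sum_i a i ^+ 2) + Num.sqrt (\sum_i b i ^+ 2).
Proof.
have cs := cauchy_schwarz_sum a b; move: cs.
set s := Num.sqrt _; set t := Num.sqrt _ => cs.
have s0 : 0 <= s by exact: sqrtr_ge0.
have t0 : 0 <= t by exact: sqrtr_ge0.
have sA : s ^+ 2 = \sum_i a i ^+ 2.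
  by rewrite sqr_sqrtr// sumr_ge0// => i _; exact: sqr_ge0.
have tB : t ^+ 2 = \sum_i b i ^+ 2.
  by rewrite sqr_sqrtr// sumr_ge0// => i _; exact: sqr_ge0.
rewrite -(ger0_norm (addr_ge0 s0 t0)) -sqrtr_sqr ler_wsqrtr//.
under eq_bigr do rewrite sqrrD.
rewrite !big_split/= -sA -tB sqrrD; lra.
Qed.

Section eucl.
Context {R : realType} {d : nat}.
Implicit Types x y z : d.-tuple R.

Lemma eucl_distC x y : eucl_dist x y = eucl_dist y x.
Proof. by congr Num.sqrt; apply: eq_bigr => i _; rewrite -sqrrN opprB. Qed.

Lemma eucl_dist_triangle y x z :
  eucl_dist x z <= eucl_dist x y + eucl_dist y z.
Proof.
rewrite /eucl_dist.
apply: le_trans (minkowski_sum (fun i => tnth x i - tnth y i)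
  (fun i => tnth y i - tnth z i)).
by rewrite le_eqVlt; apply/orP; left; apply/eqP; congr Num.sqrt;
  apply: eq_bigr => i _; rewrite addrA subrK.
Qed.

Lemma eucl_dist0x x : eucl_dist origin x = eucl_norm x.
Proof.
by congr Num.sqrt; apply: eq_bigr => i _; rewrite tnth_mktuple sub0r sqrrN.
Qed.

Lemma eucl_dist_le_coord x y (s : R) : 0 <= s ->
  (forall i, `|tnth x i - tnth y i| <= s) ->
  eucl_dist x y <= s * Num.sqrt d%:R.
Proof.
move=> s0 h; rewrite -[s in s * _](ger0_norm s0) -sqrtr_sqr -sqrtrM ?sqr_ge0//.
rewrite ler_wsqrtr// [leRHS](_ : _ = \sum_(i < d) s ^+ 2); last first.
  by rewrite sumr_const card_ord mulr_natr.
apply: ler_sum => i _; rewrite -real_normK ?num_real//.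
by apply: lerXn2r; rewrite ?nnegrE.
Qed.

Lemma coord_le_eucl_norm x i : `|tnth x i| <= eucl_norm x.
Proof.
rewrite -sqrtr_sqr ler_wsqrtr// (bigD1 i)//= lerDl.
by apply: sumr_ge0 => j _; exact: sqr_ge0.
Qed.

Definition eucl_scale (a : R) x : d.-tuple R := [tuple a * tnth x i | i < d].

Lemma eucl_norm_scale a x : eucl_norm (eucl_scale a x) = `|a| * eucl_norm x.
Proof.
rewrite -sqrtr_sqr -sqrtrM ?sqr_ge0// /eucl_norm mulr_sumr; congr Num.sqrt.
by apply: eq_bigr => i _; rewrite tnth_mktuple exprMn.
Qed.

Lemma eucl_dist_scale a x : eucl_dist x (eucl_scale a x) = `|1 - a| * eucl_norm x.
Proof.
rewrite -eucl_norm_scale; congr Num.sqrt; apply: eq_bigr => i _.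
by rewrite !tnth_mktuple mulrBl mul1r.
Qed.

End eucl.

(** * Measurability of the coverage event *)

Section eucl_measurable.
Context {R : realType} {d : nat}.

Lemma measurable_eucl_dist (z : d.-tuple R) :
  measurable_fun [set: d.-tuple R] (fun x => eucl_dist x z).
Proof.
apply: (@measurableT_comp _ _ _ _ _ _ (@Num.sqrt R)).
  by apply: continuous_measurable_fun; exact: sqrt_continuous.
apply: measurable_sum => i; apply: measurable_funX; apply: measurable_funB => //.
exact: measurable_tnth.
Qed.

Lemma measurable_eucl_norm : measurable_fun [set: d.-tuple R] eucl_norm.
Proof.
rewrite (_ : eucl_norm = fun x => eucl_dist x origin).
  exact: measurable_eucl_dist.
by apply/funext => x; rewrite eucl_distC eucl_dist0x.
Qed.

Lemma rat_tuple_dense (x : d.-tuple R) (s : R) : 0 < s ->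
  exists q : d.-tuple rat, eucl_dist x (map_tuple ratr q) <= s.
Proof.
move=> s0.
(* the [+ 1] keeps the denominator positive in dimension zero *)
pose e := s / (Num.sqrt d%:R + 1).
have dp : 0 < Num.sqrt d%:R + 1 :> R by rewrite ltr_wpDl// sqrtr_ge0.
have e0 : 0 < e by rewrite divr_gt0.
have qP i : exists q : rat, `|tnth x i - ratr q| <= e.
  have [|q] := @rat_in_itvoo R (tnth x i - e) (tnth x i + e); first by lra.
  rewrite in_itv/= => /andP[q1 q2]; exists q; rewrite ler_norml; lra.
have [q {}qP] := choice qP.
exists [tuple q i | i < d].
have : eucl_dist x (map_tuple ratr [tuple q i | i < d]) <= e * Num.sqrt d%:R.
  apply: eucl_dist_le_coord => [|i]; first exact: ltW.
  by rewrite tnth_map tnth_mktuple.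
move/le_trans; apply; rewrite /e -mulrA ler_piMr ?(ltW s0)//.
by rewrite mulrC ler_pdivrMr// mul1r lerDl.
Qed.

Lemma finite_gap (n : nat) (Q : nat -> Prop) (a : nat -> R) :
  (forall i, (i < n)%N -> Q i -> 1 < a i) ->
  exists2 e, 0 < e & forall i, (i < n)%N -> Q i -> 1 + e < a i.
Proof.
elim: n => [|n IH] h; first by exists 1.
have [i ni Qi|e e0 he] := IH; first by apply: h => //; exact: ltnW.
have [Qn|nQ] := pselect (Q n); last first.
  exists e => // i; rewrite ltnS leq_eqVlt => /orP[/eqP -> //|]; exact: he.
have an := h n (ltnSn n) Qn.
exists (Num.min e ((a n - 1) / 2)); first by rewrite lt_min e0; lra.
move=> i; rewrite ltnS leq_eqVlt => /orP[/eqP -> _|ni Qi].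
  have : Num.min e ((a n - 1) / 2) <= (a n - 1) / 2 by rewrite ge_min lexx orbT.
  lra.
apply: le_lt_trans (he _ ni Qi); by rewrite lerD2l ge_min lexx.
Qed.

(** Non-coverage is an open condition on the uncovered point [y]; pulling [y]
slightly towards the centre makes room for a rational point that stays in the
ball, so that only countably many candidates matter. *)
Lemma uncovered_rational (n : nat) (r : R) (x : nat -> d.-tuple R) (y : d.-tuple R) :
  0 < r -> eucl_dist origin y <= r ->
  (forall i, (i < n)%N -> eucl_dist origin (x i) <= r -> 1 < eucl_dist (x i) y) ->
  exists2 q : d.-tuple rat, eucl_dist origin (map_tuple ratr q) <= r &
    forall i, (i < n)%N -> eucl_dist origin (x i) <= r ->
      1 < eucl_dist (x i) (map_tuple ratr q).
Proof.
move=> r0 yr /finite_gap[e e0 he].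
(* [t] moves [y] by at most [t * r], and the rational point is another [t * r]
   away: together at most the margin [e] *)
pose t := Num.min 1 (e / (2 * r)).
have r20 : 0 < 2 * r by rewrite mulr_gt0.
have t0 : 0 < t by rewrite lt_min ltr01 divr_gt0.
have t1 : t <= 1 by rewrite ge_min lexx.
have tr0 : 0 < t * r by rewrite mulr_gt0.
have te : 2 * (t * r) <= e.
  by rewrite mulrCA -ler_pdivlMr// ge_min lexx orbT.
have [q hq] := rat_tuple_dense (eucl_scale (1 - t) y) tr0.
set z := map_tuple _ _ in hq *.
have yr' := yr; rewrite eucl_dist0x in yr'.
have tyr : t * eucl_norm y <= t * r by rewrite ler_pM2l.
exists q.
  apply: le_trans (eucl_dist_triangle (eucl_scale (1 - t) y) _ _) _.
  rewrite eucl_dist0x eucl_norm_scale ger0_norm ?subr_ge0//.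
  have : (1 - t) * eucl_norm y <= (1 - t) * r by rewrite ler_wpM2l// subr_ge0.
  rewrite -/z; lra.
move=> i ni xi; have h := he i ni xi.
have := eucl_dist_triangle z (x i) y.
have := eucl_dist_triangle (eucl_scale (1 - t) y) y z.
rewrite (eucl_distC z y) eucl_dist_scale subKr ger0_norm ?(ltW t0)//.
rewrite -/z; lra.
Qed.

End eucl_measurable.

Lemma measurable_cover_event {R : realType} {d : nat} {disp : measure_display}
    {T : measurableType disp} {P : probability T R}
    (X : nat -> {RV P >-> d.-tuple R}) (n : nat) (r : R) :
  0 < r -> measurable (cover_event X n r).
Proof.
move=> r0.
pose near_pt (q : d.-tuple rat) (i : nat) : set T :=
  [set w | eucl_dist origin (X i w) <= r] `&`
  [set w | eucl_dist (X i w) (map_tuple ratr q) <= 1].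
pose far (q : d.-tuple rat) : set T :=
  if eucl_dist origin (map_tuple ratr q) <= r :> R
  then ~` \bigcup_(i in `I_n) near_pt q i else set0.
rewrite (_ : cover_event X n r = ~` \bigcup_q far q).
  apply: measurableC; apply: countable_bigcupT_measurable => // q.
  rewrite /far; case: ifP => // _; apply: measurableC.
  apply: fin_bigcup_measurable => // i _; apply: measurableI.
    rewrite (_ : [set _ | _] = (fun w => eucl_norm (X i w)) @^-1` `]-oo, r]).
      rewrite -[X in measurable X]setTI; apply: (measurableT_comp measurable_eucl_norm) => //.
    by apply/seteqP; split=> w /=; rewrite eucl_dist0x in_itv.
  rewrite (_ : [set _ | _] =
     (fun w => eucl_dist (X i w) (map_tuple ratr q)) @^-1` `]-oo, 1]).
    rewrite -[X in measurable X]setTI.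
    by apply: (measurableT_comp (measurable_eucl_dist _)) => //.
  by apply/seteqP; split=> w /=; rewrite in_itv.
apply/seteqP; split=> w.
  move=> cov [q _]; rewrite /far; case: ifPn => // qr; apply.
  have [_ [[i ni <-] xr] xq] := cov _ qr.
  by exists i.
move=> unc y yr; apply: contrapT => nc; apply: unc.
have [|q qr hq] := @uncovered_rational R d n r (fun i => X i w) y r0 yr.
  move=> i ni xr; rewrite ltNge; apply/negP => xy; apply: nc.
  by exists (X i w) => //; split=> //; exists i.
exists q => //; rewrite /far qr => -[i ni [xr xq]].
by have := hq i ni xr; rewrite ltNge xq.
Qed.

(** * Probability of missing a cube *)

Section cubes.
Context {R : realType} {d : nat}.

Definition cube (a : 'I_d -> R) (s : R) : set (d.-tuple R) :=
  [set x | forall i, `[a i, a i + s]%classic (tnth x i)].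

Lemma cube_dist (a : 'I_d -> R) (s : R) (x y : d.-tuple R) :
  0 <= s -> cube a s x -> cube a s y -> eucl_dist x y <= s * Num.sqrt d%:R.
Proof.
move=> s0 ax ay; apply: eucl_dist_le_coord => // i.
have /= := ax i; have /= := ay i; rewrite !in_itv/= ler_norml; lra.
Qed.

Lemma measurable_cube (a : 'I_d -> R) (s : R) : measurable (cube a s).
Proof.
rewrite (_ : cube a s = \big[setI/setT]_(i < d)
   ((fun x : d.-tuple R => tnth x i) @^-1` `[a i, a i + s])).
  apply: bigsetI_measurable => i _; rewrite -[X in measurable X]setTI.
  exact: measurable_tnth.
apply/seteqP; split=> x /=; rewrite -bigcap_seq => h i; first by move=> _; exact: h.
by apply: (h i) => /=; exact: mem_index_enum.
Qed.

Lemma lebesgue_tuple_cube (a : 'I_d -> R) (s : R) :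
  0 <= s -> lebesgue_tuple d (cube a s) = (s ^+ d)%:E.
Proof.
move=> s0; rewrite (lebesgue_tuple_box (A := fun i => `[a i, a i + s]%classic))//.
under eq_bigr => i _.
  rewrite lebesgue_measure_itv/= lte_fin.
  rewrite (_ : (if _ then _ else _) = s%:E); first over.
  by case: ltP => [_|]; [rewrite -EFinD addrAC subrr add0r|
    move=> ?; congr EFin; lra].
by rewrite prodEFin prodr_const card_ord.
Qed.

End cubes.

Section coverage_probability.
Context {R : realType} {d : nat} {disp : measure_display}.
Context {T : measurableType disp} {P : probability T R}.
Implicit Types (X : nat -> {RV P >-> d.-tuple R}).
Local Open Scope ereal_scope.

Lemma measurable_RV_preimage (Y : {RV P >-> d.-tuple R}) (Q : set (d.-tuple R)) :
  measurable Q -> measurable (Y @^-1` Q).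
Proof. by move=> mQ; rewrite -[X in measurable X]setTI; exact: measurable_funP. Qed.

Lemma cube_probability_ge (Y : {RV P >-> d.-tuple R}) (f : d.-tuple R -> R)
    (a : 'I_d -> R) (s m : R) :
  has_density Y f -> measurable_fun setT f -> (0 <= m)%R -> (0 <= s)%R ->
  (forall x, cube a s x -> (m <= f x)%R) ->
  (m * s ^+ d)%:E <= P (Y @^-1` cube a s).
Proof.
move=> Yf mf m0 s0 mle.
have mQ := measurable_cube a s.
rewrite [leRHS](Yf _ mQ) EFinM -(lebesgue_tuple_cube a s0) -integral_cst//.
apply: ge0_le_integral => //.
by apply/measurable_EFinP; exact: measurable_funTS.
Qed.

(** By independence this is a product of [n] factors, each at most
[1 - q <= exp (- q)]. *)
Lemma miss_probability_le X (f : d.-tuple R -> R) (Q : set (d.-tuple R))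
    (q : R) (n : nat) :
  mutually_independent X -> measurable Q ->
  (forall i, q%:E <= P (X i @^-1` Q)) ->
  P (\big[setI/setT]_(i <- iota 0 n) (X i @^-1` (~` Q))) <=
    (expR (- (n%:R * q)))%:E.
Proof.
move=> indep mQ qle; rewrite (indep (iota 0 n) (fun=> ~` Q))//; last first.
- by move=> i; exact: measurableC.
- exact: iota_uniq.
have one i : P (X i @^-1` (~` Q)) <= (expR (- q))%:E.
  rewrite -preimage_setC probability_setC//; last exact: measurable_RV_preimage.
  apply: (@le_trans _ _ (1 - q%:E)); first by rewrite leeB.
  by rewrite -EFinB lee_fin expR_ge1Dx.
rewrite -mulrN expRM_natl -[in leRHS](size_iota 0 n).
elim: (iota 0 n) => [|i l IH]; first by rewrite big_nil expr0.
by rewrite big_cons/= exprS EFinM lee_pmul// prode_ge0.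
Qed.

Lemma union_bound (J : Type) (l : seq J) (E : J -> set T) (b : R) :
  (forall j, measurable (E j)) -> (forall j, P (E j) <= b%:E) ->
  P (\big[setU/set0]_(j <- l) E j) <= ((size l)%:R * b)%:E.
Proof.
move=> mE Eb; elim: l => [|j l IH]; first by rewrite big_nil measure0 mul0r.
rewrite big_cons/= -natr1 mulrDl mul1r addrC EFinD.
apply: le_trans (leeD (Eb j) IH); apply: measureU2 => //.
exact: bigsetU_measurable.
Qed.

(** Coverage can only fail if one of the cubes contained in the ball is missed
by all the sample points, and each single miss has probability at most
[(1 - q)^n <= exp (- n q)], where [q] bounds the mass of a cube from below. *)
Lemma uncovered_probability_le X (f : d.-tuple R -> R) (n : nat) (r m s : R)
    (J : finType) (a : J -> 'I_d -> R) :
  iid_from X f -> measurable_fun setT f -> (0 < r)%R -> (0 <= m)%R -> (0 <= s)%R ->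
  (forall x, (eucl_norm x <= r)%R -> (m <= f x)%R) ->
  (forall y, eucl_ball origin r y ->
    exists j, cube (a j) s `<=` eucl_ball origin r `&` eucl_ball y 1) ->
  P (~` cover_event X n r) <= (#|J|%:R * expR (- (n%:R * (m * s ^+ d))))%:E.
Proof.
move=> [indep dens] mf r0 m0 s0 mle cov.
pose miss j := \big[setI/setT]_(i <- iota 0 n) (X i @^-1` (~` cube (a j) s)).
(* cubes that stick out of the ball are discarded by an empty event *)
pose E j := if `[< cube (a j) s `<=` eucl_ball origin r >] then miss j else set0.
have mE j : measurable (E j).
  rewrite /E; case: ifP => // _; apply: bigsetI_measurable => i _.
  by apply: measurable_RV_preimage; apply: measurableC; exact: measurable_cube.
have PE j : P (E j) <= (expR (- (n%:R * (m * s ^+ d))))%:E.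
  rewrite /E; case: ifPn => [/asboolP sub|_]; last by rewrite measure0 lee_fin expR_ge0.
  apply: miss_probability_le => //; first exact: measurable_cube.
  move=> i; apply: cube_probability_ge => // x ax; apply: mle.
  by have := sub x ax; rewrite /eucl_ball/= eucl_dist0x.
rewrite cardE enumT; apply: le_trans (union_bound (Finite.enum J) mE PE).
apply: le_measure; rewrite ?inE.
- by apply: measurableC; exact: measurable_cover_event.
- exact: bigsetU_measurable.
move=> w /= nc; apply: contrapT => nE; apply: nc => y yr.
have [j ajQ] := cov y yr.
have /asboolP sub : cube (a j) s `<=` eucl_ball origin r by move=> x /ajQ[].
have nEj : ~ E j w.
  move=> Ej; apply: nE; rewrite -bigcup_seq; exists j => //=.
  by rewrite -enumT mem_enum.
move: nEj; rewrite /E sub /miss -bigcap_seq => /existsNP[i /not_implyP[/= il /contrapT ax]].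
have [xr xy] := ajQ _ ax.
exists (X i w); last by rewrite /eucl_ball/= eucl_distC.
split=> //; exists i => //; move: il; by rewrite mem_iota.
Qed.

End coverage_probability.

(** * Cubes inside a ball *)

Section grid.
Context {R : realType} (d : nat).
Hypothesis d1 : (1 <= d)%N.

(** The side for which a cube has diameter [1/2]. *)
Definition mesh : R := (2 * Num.sqrt d%:R)^-1.

Lemma mesh_gt0 : 0 < mesh.
Proof. by rewrite invr_gt0 mulr_gt0// sqrtr_gt0 ltr0n. Qed.

Lemma mesh_diam : mesh * Num.sqrt d%:R = 2^-1.
Proof.
rewrite /mesh invfM mulfVK// gt_eqF// sqrtr_gt0.
by rewrite ltr0n.
Qed.

(** The point [y] is first pulled towards the centre by at most [1/2], so that the
cube around the new point, of diameter [1/2], cannot leave the ball. The indices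
are shifted by [M] to make them natural numbers. *)
Lemma large_ball_grid (r : R) : 2^-1 <= r ->
  exists (M : nat) (a : {ffun 'I_d -> 'I_(2 * M)} -> 'I_d -> R),
    M%:R <= r / mesh + 1 /\
    forall y : d.-tuple R, eucl_ball origin r y ->
      exists j, cube (a j) mesh `<=` eucl_ball origin r `&` eucl_ball y 1.
Proof.
move=> r2; have g0 := mesh_gt0.
have gi : 0 < mesh^-1 by rewrite invr_gt0.
have r0 : 0 < r by apply: lt_le_trans r2; rewrite invr_gt0.
pose M := (Num.truncn (r / mesh)).+1.
have /andP[M1 M2] := truncn_itv (divr_ge0 (ltW r0) (ltW g0)).
exists M, (fun (j : {ffun 'I_d -> 'I_(2 * M)}) i => mesh * ((j i)%:R - M%:R)); split.
  by rewrite /M -natr1 lerD2r.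
move=> y yr; rewrite /eucl_ball/= eucl_dist0x in yr.
pose t := (2 * r)^-1.
have tr : t * r = 2^-1 by rewrite /t invfM mulfVK// gt_eqF.
have t0 : 0 < t by rewrite invr_gt0 mulr_gt0.
have t1 : t <= 1.
  rewrite invf_le1 ?mulr_gt0//; lra.
pose z := eucl_scale (1 - t) y.
have zr : eucl_norm z <= r - 2^-1.
  rewrite eucl_norm_scale ger0_norm ?subr_ge0//.
  have : (1 - t) * eucl_norm y <= (1 - t) * r by rewrite ler_wpM2l// subr_ge0.
  by rewrite [(1 - t) * r]mulrBl tr mul1r.
have yz : eucl_dist y z <= 2^-1.
  by rewrite eucl_dist_scale subKr ger0_norm ?(ltW t0)// -tr ler_pM2l.
have kP i : exists k : 'I_(2 * M),
    `[mesh * (k%:R - M%:R), mesh * (k%:R - M%:R) + mesh]%classic (tnth z i).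
  pose u := tnth z i / mesh.
  have uz : tnth z i = mesh * u by rewrite /u mulrC divfK// gt_eqF.
  have : `|u| < M%:R.
    apply: le_lt_trans M2; rewrite normrM [`|mesh^-1|]ger0_norm ?(ltW gi)//.
    rewrite ler_pM2r ?gi//; apply: le_trans (coord_le_eucl_norm z i) _.
    by apply: le_trans zr _; rewrite lerBlDr lerDl invr_ge0.
  rewrite ltr_norml => /andP[u1 u2].
  have /andP[k1 k2] : (Num.truncn (u + M%:R))%:R <= u + M%:R
      < (Num.truncn (u + M%:R)).+1%:R by apply: truncn_itv; lra.
  have kM : (Num.truncn (u + M%:R) < 2 * M)%N.
    by rewrite -(ltr_nat R) natrM; apply: le_lt_trans k1 _; lra.
  have gD a : mesh * a + mesh = mesh * (a + 1) by rewrite mulrDr mulr1.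
  exists (Ordinal kM); rewrite /= in_itv/= uz gD !ler_pM2l//.
  by rewrite -natr1 in k2; apply/andP; split; lra.
have [k {}kP] := choice kP.
exists [ffun i => k i] => x ax.
have xz : eucl_dist z x <= 2^-1.
  rewrite -mesh_diam; apply: (cube_dist (ltW g0) _ ax) => i.
  by rewrite ffunE.
split.
  rewrite /eucl_ball/=; apply: le_trans (eucl_dist_triangle z _ _) _.
  rewrite eucl_dist0x; lra.
rewrite /eucl_ball/=; apply: le_trans (eucl_dist_triangle z _ _) _; lra.
Qed.

(** A ball of radius at most [1/2] lies within [1] of each of its points; the side
is chosen for the cube to have diameter [rho]. *)
Lemma small_ball_cube (rho r : R) : 0 < rho -> rho <= r -> r <= 2^-1 ->
  forall y : d.-tuple R, eucl_ball origin r y ->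
    cube (fun=> 0) (2 * rho * mesh) `<=` eucl_ball origin r `&` eucl_ball y 1.
Proof.
move=> rho0 rhor r2 y yr x ax; have g0 := mesh_gt0.
have xrho : eucl_dist origin x <= rho.
  rewrite (_ : rho = 2 * rho * mesh * Num.sqrt d%:R); last first.
    by rewrite -mulrA mesh_diam mulrAC mulfV ?mul1r.
  have s0 : 0 <= 2 * rho * mesh by rewrite ltW// !mulr_gt0.
  apply: (cube_dist s0 _ ax) => i.
  by rewrite tnth_mktuple /= in_itv/= add0r lexx.
split; first exact: le_trans rhor.
rewrite /eucl_ball/=; apply: le_trans (eucl_dist_triangle origin _ _) _.
by rewrite (eucl_distC y); move: yr; rewrite /eucl_ball/=; lra.
Qed.

End grid.

(** * Reduction of coverage to a numerical limit *)

(** The first factor bounds the number of grid cubes needed for the ball of radius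
[rho], the second the probability of missing one of them when the density is at
least [m] on the ball. *)
Definition grid_bound {R : realType} (d n : nat) (rho m : R) : R :=
  (2 * (rho / mesh d + 1)) ^+ d * expR (- (n%:R * (m * mesh d ^+ d))).

Section coverage_limit.
Context {R : realType} {d : nat} {disp : measure_display}.
Context {T : measurableType disp} {P : probability T R}.
Hypothesis d1 : (1 <= d)%N.
Variables (X : nat -> {RV P >-> d.-tuple R}) (f : d.-tuple R -> R).
Hypotheses (iidX : iid_from X f) (mf : measurable_fun setT f).

(** The cubes are cut in the actual ball of radius [r], but counted and weighed at
the larger radius [rho], since only [rho] will be known explicitly. *)
Lemma uncovered_probability_large (n : nat) (r rho m : R) :
  2^-1 <= r -> r <= rho -> 0 <= m ->
  (forall x, eucl_norm x <= rho -> m <= f x) ->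
  (P (~` cover_event X n r) <= (grid_bound d n rho m)%:E)%E.
Proof.
move=> r2 rrho m0 mle; have g0 := @mesh_gt0 R d d1.
have r0 : 0 < r by apply: lt_le_trans r2; rewrite invr_gt0.
have [M [a [Mr cov]]] := large_ball_grid d1 r2.
have := uncovered_probability_le n iidX mf r0 m0 (ltW g0)
  (fun x xr => mle x (le_trans xr rrho)) cov.
move/le_trans; apply; rewrite lee_fin ler_wpM2r ?expR_ge0//.
rewrite card_ffun !card_ord natrX; apply: lerXn2r; rewrite ?nnegrE//.
- by rewrite mulr_ge0// addr_ge0// divr_ge0// ltW// (lt_le_trans r0).
- rewrite natrM ler_pM2l//; apply: le_trans Mr _.
  by rewrite lerD2r ler_pM2r// invr_gt0.
Qed.

Lemma uncovered_probability_small (n : nat) (r rho m : R) :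
  0 < rho -> rho <= r -> r <= 2^-1 -> 0 <= m ->
  (forall x, eucl_norm x <= 2^-1 -> m <= f x) ->
  (P (~` cover_event X n r) <=
     (expR (- (n%:R * (m * (2 * rho * mesh d) ^+ d))))%:E)%E.
Proof.
move=> rho0 rhor r2 m0 mle; have g0 := @mesh_gt0 R d d1.
have r0 : 0 < r by exact: lt_le_trans rhor.
have s0 : 0 <= 2 * rho * mesh d by rewrite ltW// !mulr_gt0.
have cov (y : d.-tuple R) : eucl_ball origin r y -> exists j : unit,
    cube ((fun=> fun=> 0) j) (2 * rho * mesh d) `<=`
    eucl_ball origin r `&` eucl_ball y 1.
  by move=> yr; exists tt; exact: (small_ball_cube d1 rho0).
have := uncovered_probability_le n iidX mf r0 m0 s0
  (fun x xr => mle x (le_trans xr r2)) cov.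
by rewrite card_unit mul1r.
Qed.

Lemma cvg_expR_linear (k : R) : 0 < k -> expR (- (n%:R * k)) @[n --> \oo] --> (0 : R).
Proof.
move=> k0.
have mulk : (x * k : R) @[x --> +oo] --> +oo by exact: (gt0_cvgMly k0 cvg_id).
have nk : (n%:R * k : R) @[n --> \oo] --> +oo := cvg_comp _ _ cvgr_idn mulk.
exact: (cvg_comp _ _ nk (@cvgr_expR R)).
Qed.

(** For each [n] one of the two bounds applies, according to whether [r n] exceeds
[1/2]; their sum bounds the failure probability in both cases. Monotonicity of
[r] provides the fixed cube, inside the ball of radius [r 1], for small radii. *)
Lemma coverage_probability_cvg1 (r rho m : nat -> R) (m0 : R) :
  (forall n, (1 <= n)%N -> 0 < r n) ->
  (forall k n, (1 <= k)%N -> (k <= n)%N -> r k <= r n) ->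
  0 < m0 -> (forall x, eucl_norm x <= 2^-1 -> m0 <= f x) ->
  (\forall n \near \oo, [/\ r n <= rho n, 0 <= m n &
     forall x, eucl_norm x <= rho n -> m n <= f x]) ->
  grid_bound d n (rho n) (m n) @[n --> \oo] --> (0 : R) ->
  P (cover_event X n (r n)) @[n --> \oo] --> 1%E.
Proof.
move=> rpos rinc m00 m0le near_rho gcvg; have g0 := @mesh_gt0 R d d1.
have r10 : 0 < r 1%N by exact: rpos.
pose b1 n := grid_bound d n (rho n) (m n).
pose b2 n : R := expR (- (n%:R * (m0 * (2 * r 1%N * mesh d) ^+ d))).
have b2cvg : b2 n @[n --> \oo] --> (0 : R).
  by apply: cvg_expR_linear; rewrite mulr_gt0// exprn_gt0// !mulr_gt0.
have lowcvg : (1 - (b1 n + b2 n)%:E)%E @[n --> \oo] --> 1%E.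
  apply: (@cvg_trans _ ((1 - (b1 n + b2 n))%:E @[n --> \oo])) => //.
  apply: cvg_EFin; first by near=> n.
  rewrite -[1 in X in _ --> X]subr0; apply: cvgB; first exact: cvg_cst.
  by rewrite -[0 in X in _ --> X](addr0 0); apply: cvgD.
apply: (squeeze_cvge _ lowcvg (cvg_cst _)).
near=> n.
have n1 : (1 <= n)%N by near: n; exact: nbhs_infty_ge.
have rn0 := rpos n n1.
have mC := measurable_cover_event X n rn0.
rewrite probability_le1// andbT leeBlDr//.
have -> : (1 = P (cover_event X n (r n)) + P (~` cover_event X n (r n)))%E.
  rewrite probability_setC// addeC subeK// fin_num_measure//.
apply: leeD2l.
have [rr mn mle] : [/\ r n <= rho n, 0 <= m n &
     forall x, eucl_norm x <= rho n -> m n <= f x] by near: n.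
have [r2|/ltW r2] := leP (2^-1) (r n).
  apply: le_trans (uncovered_probability_large n r2 rr mn mle) _.
  by rewrite lee_fin lerDl expR_ge0.
apply: le_trans (uncovered_probability_small n r10 (rinc 1%N n isT n1) r2 (ltW m00) m0le) _.
rewrite lee_fin lerDr mulr_ge0 ?expR_ge0// exprn_ge0// mulr_ge0// addr_ge0//.
by rewrite divr_ge0// ltW// (lt_le_trans rn0).
Unshelve. all: by end_near.
Qed.

End coverage_limit.

(** * The radial densities *)

Section profile.
Context {R : realType}.

(** Nonincreasing in [t >= 0], so that its value at the radius of a ball bounds the
model density from below on that ball. *)
Definition density_profile (fam : density_family R) (c t : R) : R :=
  match fam with
  | PowerLaw alpha => c / (1 + t `^ alpha)
  | Exponential => c * expR (- t)
  | Gaussian => c * expR (- (t ^+ 2 / 2))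
  end.

Lemma density_profile_gt0 fam (c t : R) : 0 < c -> 0 < density_profile fam c t.
Proof.
move=> c0; case: fam => [alpha||] /=; rewrite ?mulr_gt0 ?expR_gt0//.
by rewrite invr_gt0 ltr_wpDr// powR_ge0.
Qed.

Lemma density_profile_le_model {d : nat} fam (c rho : R) (x : d.-tuple R) :
  admissible_family d fam -> 0 < c -> eucl_norm x <= rho ->
  density_profile fam c rho <= model_density fam c x.
Proof.
have x0 : 0 <= eucl_norm x by exact: sqrtr_ge0.
case: fam => [alpha||] /= adm c0 xr; rewrite ler_pM2l//.
- have a0 : 0 <= alpha by apply: le_trans (ltW adm); exact: ler0n.
  have pos t : 0 < 1 + t `^ alpha by rewrite ltr_wpDr// powR_ge0.
  rewrite lef_pV2 ?posrE// lerD2l; apply: ge0_ler_powR => //.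
  by rewrite nnegrE (le_trans x0).
- by rewrite ler_expR lerN2.
- rewrite ler_expR lerN2 ler_pM2r ?invr_gt0//.
  by apply: lerXn2r; rewrite ?nnegrE ?(le_trans x0).
Qed.

Lemma measurable_model_density {d : nat} fam (c : R) :
  measurable_fun [set: d.-tuple R] (model_density fam c).
Proof.
have mprofile : measurable_fun setT (density_profile fam c).
  case: fam => [alpha||] /=; apply: measurable_funM => //.
  (* the inverse is a real power, since the denominator is nonnegative *)
  - rewrite (_ : (fun t : R => _) = (fun t => (1 + t `^ alpha) `^ (- 1))).
      apply: (measurableT_comp (measurable_powR (- 1))).
      by apply: measurable_funD => //; exact: measurable_powR.
    by apply/funext => t; rewrite powR_inv1// addr_ge0// powR_ge0.
  - by apply: measurableT_comp => //; exact: oppr_measurable.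
  - apply: measurableT_comp => //; apply: measurableT_comp => //.
    by apply: measurable_funM => //; exact: measurable_funX.
rewrite (_ : model_density fam c = density_profile fam c \o eucl_norm).
  exact: measurableT_comp measurable_eucl_norm.
by apply/funext => x; case: fam {mprofile}.
Qed.

End profile.

(** * Calibration of the constants *)

Section estimates.
Context {R : realType} (d : nat).
Hypothesis d1 : (1 <= d)%N.
Local Notation g := (@mesh R d).

Let d0 : 0 < d%:R :> R. Proof. by rewrite ltr0n. Qed.

Lemma expR_ge_sqr (x : R) : 0 <= x -> (1 + x / 2) ^+ 2 <= expR x.
Proof.
move=> x0; rewrite [in leRHS](_ : x = 2%:R * (x / 2)); last by field.
rewrite expRM_natl; apply: lerXn2r; rewrite ?nnegrE ?expR_ge0 ?expR_ge1Dx//.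
by rewrite addr_ge0// divr_ge0.
Qed.

Lemma expR_ge_double (x : R) : 0 <= x -> 2 * x <= expR x.
Proof.
move=> x0; apply: le_trans (expR_ge_sqr x0).
rewrite -subr_ge0 (_ : _ - _ = (1 - x / 2) ^+ 2) ?sqr_ge0//; by field.
Qed.

Lemma expR_ln_dim :
  expR ((1 + d%:R / 2) * ln d%:R) = d%:R * Num.sqrt d%:R ^+ d :> R.
Proof.
rewrite mulrDl mul1r expRD lnK ?posrE//; congr (_ * _).
rewrite -powR12_sqrt ?ler0n// /powR (gt_eqF d0) -expRM_natl; congr expR.
by field.
Qed.

Lemma mesh_powE : g ^+ d = (2 ^+ d * Num.sqrt d%:R ^+ d)^-1.
Proof. by rewrite /mesh exprVn exprMn. Qed.

(** The three identities below say what [delta] is made for: the cube volume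
[mesh^d] and the normalization cancel, and only the dimension survives. *)
Lemma expR_delta_exponential (c : R) : 0 < c ->
  c * expR (delta d Exponential c) * g ^+ d = d%:R.
Proof.
move=> c0; rewrite /= !expRD expRN lnK ?posrE// expR_ln_dim expRM_natl lnK ?posrE//.
rewrite mesh_powE; field; rewrite !lt0r_neq0 ?exprn_gt0 ?sqrtr_gt0//.
Qed.

Lemma expR_delta_gaussian (c : R) : 0 < c ->
  c * expR (delta d Gaussian c) * g ^+ d = d%:R / 2.
Proof.
move=> c0; rewrite -(expR_delta_exponential c0)/=.
rewrite (_ : _ - ln c = (1 + d%:R / 2) * ln d%:R + d%:R * ln 2 - ln c - ln 2); last ring.
rewrite [in LHS]expRD [expR (- ln 2)]expRN lnK ?posrE//; by field.
Qed.

Lemma delta_power_law (alpha c : R) :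
  delta d (PowerLaw alpha) c = c * alpha * g ^+ d / d%:R.
Proof.
rewrite /= powRN /powR (gt_eqF d0) expR_ln_dim mesh_powE; field.
by rewrite !lt0r_neq0 ?exprn_gt0 ?sqrtr_gt0.
Qed.

Lemma ln_cvgy : ln x @[x --> +oo] --> (+oo : set_system R).
Proof.
apply/cvgryPge => A; near=> x.
by rewrite -[A]expRK ler_ln ?posrE ?expR_gt0//; near: x; apply: nbhs_pinfty_ge; exact: num_real.
Unshelve. all: by end_near.
Qed.

Lemma ln_nat_cvgy : (ln n%:R : R) @[n --> \oo] --> +oo.
Proof. exact: (cvg_comp _ _ cvgr_idn ln_cvgy). Qed.

Lemma lnln_nat_cvgy : (ln (ln n%:R) : R) @[n --> \oo] --> +oo.
Proof. exact: (cvg_comp _ _ ln_nat_cvgy ln_cvgy). Qed.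

(** The number of cubes is controlled by [expR (d * e n)]; the last hypothesis
weighs this entropy against the expected number of points in a cube. *)
Lemma grid_bound_cvg0 (rho m e : nat -> R) (B k : R) : 0 < k ->
  (\forall n \near \oo, [/\ 0 <= rho n, rho n / g + 1 <= B * expR (e n) &
     d%:R * e n - n%:R * (m n * g ^+ d) <= - (ln (ln n%:R) * k)]) ->
  grid_bound d n (rho n) (m n) @[n --> \oo] --> (0 : R).
Proof.
move=> k0 near_e; have g0 := @mesh_gt0 R d d1.
have up : (2 * B) ^+ d * expR (- (ln (ln n%:R) * k)) @[n --> \oo] --> (0 : R).
  rewrite -[0 in X in _ --> X](mulr0 ((2 * B) ^+ d)); apply: cvgM; first exact: cvg_cst.
  have mulk : (x * k : R) @[x --> +oo] --> +oo by exact: (gt0_cvgMly k0 cvg_id).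
  have lk : (ln (ln n%:R) * k : R) @[n --> \oo] --> +oo := cvg_comp _ _ lnln_nat_cvgy mulk.
  exact: (cvg_comp _ _ lk (@cvgr_expR R)).
apply: (squeeze_cvgr _ (cvg_cst 0) up); near=> n.
have [rho0 rhoB en] : [/\ 0 <= rho n, rho n / g + 1 <= B * expR (e n) &
     d%:R * e n - n%:R * (m n * g ^+ d) <= - (ln (ln n%:R) * k)] by near: n.
have q0 : 0 <= rho n / g + 1 by rewrite addr_ge0// divr_ge0// ltW.
rewrite /grid_bound mulr_ge0 ?expR_ge0 ?exprn_ge0//=; last by rewrite mulr_ge0.
have B0 : 0 <= B by rewrite -(pmulr_lge0 _ (expR_gt0 (e n))) (le_trans q0).
apply: (@le_trans _ _ ((2 * B * expR (e n)) ^+ d * expR (- (n%:R * (m n * g ^+ d))))).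
  rewrite ler_wpM2r ?expR_ge0//; apply: lerXn2r; rewrite ?nnegrE ?mulr_ge0 ?expR_ge0//.
  by rewrite -mulrA ler_pM2l.
rewrite exprMn -expRM_natl -mulrA -expRD ler_wpM2l ?ler_expR//.
by rewrite exprn_ge0// mulr_ge0.
Unshelve. all: by end_near.
Qed.

End estimates.

(** * Limits at the critical radius *)

Section critical.
Context {R : realType} (d : nat).
Hypothesis d1 : (1 <= d)%N.
Local Notation g := (@mesh R d).

Let d0 : 0 < d%:R :> R. Proof. by rewrite ltr0n. Qed.
Let g0 : 0 < g. Proof. exact: mesh_gt0. Qed.
Let gi0 : 0 < g^-1. Proof. by rewrite invr_gt0. Qed.

(** The lower bound [n m mesh^d] for the expected number of points in a cube, when
[m = c * exp (- u)] with [u = L - ln ln L - D - eps] and [L = ln n]. Both light-tailed models have this form, with [u] the radius or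
half its square. *)
Lemma expected_cube_count (c D eps : R) (n : nat) : (0 < n)%N ->
  0 < ln (ln (n%:R : R)) ->
  n%:R * (c * expR (- (ln n%:R - ln (ln (ln n%:R)) - D - eps)) * g ^+ d) =
  expR eps * ln (ln n%:R) * (c * expR D * g ^+ d).
Proof.
move=> n0 l20; have n0' : 0 < n%:R :> R by rewrite ltr0n.
rewrite !opprB !expRD expRN !lnK ?posrE//.
by field; rewrite lt0r_neq0.
Qed.

Lemma near_logs (A : R) : \forall n \near \oo,
  [/\ (0 < n)%N, A <= ln n%:R, 1 <= ln (n%:R : R) & 1 <= ln (ln (n%:R : R))].
Proof.
have near_ge u (a : R) : u n @[n --> \oo] --> +oo -> \forall n \near \oo, a <= u n.
  by move=> /cvgryPge.
near=> n; split; near: n.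
- exact: nbhs_infty_ge.
- by apply: near_ge; exact: ln_nat_cvgy.
- by apply: near_ge; exact: ln_nat_cvgy.
- by apply: near_ge; exact: lnln_nat_cvgy.
Unshelve. all: by end_near.
Qed.

(** Only the order [L] of the radius matters for the number of cubes, [D] being of
either sign. *)
Lemma log_radius_le (D eps L l3 : R) : 0 < eps -> 1 <= L -> 0 <= l3 ->
  L - l3 - D - eps <= (1 + `|D|) * L.
Proof.
move=> e0 L1 l30; rewrite mulrDl mul1r.
have : `|D| * 1 <= `|D| * L by rewrite ler_wpM2l.
have := ler_norm (- D); rewrite normrN; lra.
Qed.

(** There are of order [L^d = exp (d l)] cubes, each expecting [d (exp eps) l]
points, where [l = ln L]. *)
Lemma grid_bound_exponential (c eps : R) : 0 < c -> 0 < eps ->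
  let rho := critical_radius d Exponential c eps in
  (\forall n \near \oo, 0 < rho n) ->
  grid_bound d n (rho n) (density_profile Exponential c (rho n))
    @[n --> \oo] --> (0 : R).
Proof.
move=> c0 e0 rho rho0.
set D := delta d Exponential c.
apply: (grid_bound_cvg0 (e := fun n => ln (ln n%:R)) (B := (1 + `|D|) / g + 1)
  (k := d%:R * (expR eps - 1)) d1).
  by rewrite mulr_gt0// subr_gt0 -expR0 ltr_expR.
near=> n.
have [n0 _ L1 l21] : [/\ (0 < n)%N, 0 <= ln (n%:R : R), 1 <= ln (n%:R : R) &
  1 <= ln (ln (n%:R : R))] by near: n; exact: near_logs.
have L0 : 0 < ln (n%:R : R) by exact: lt_le_trans L1.
split.
- by apply: ltW; near: n.
- rewrite lnK ?posrE// [leRHS]mulrDl mul1r; apply: lerD => //.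
  rewrite mulrAC (ler_pM2r gi0).
  by apply: log_radius_le => //; exact: ln_ge0.
- have rhoE : rho n = ln n%:R - ln (ln (ln n%:R)) - D - eps by [].
  rewrite /density_profile rhoE expected_cube_count//.
    rewrite expR_delta_exponential//; lra.
  exact: lt_le_trans l21.
Unshelve. all: by end_near.
Qed.

(** There are of order [L^(d / 2)] cubes, each expecting [(d / 2) (exp eps) l]
points. *)
Lemma grid_bound_gaussian (c eps : R) : 0 < c -> 0 < eps ->
  let rho := critical_radius d Gaussian c eps in
  (\forall n \near \oo, 0 < rho n) ->
  grid_bound d n (rho n) (density_profile Gaussian c (rho n))
    @[n --> \oo] --> (0 : R).
Proof.
move=> c0 e0 rho rho0.
set D := delta d Gaussian c.
apply: (grid_bound_cvg0 (e := fun n => ln (ln n%:R) / 2)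
  (B := Num.sqrt (2 * (1 + `|D|)) / g + 1)
  (k := d%:R / 2 * (expR eps - 1)) d1).
  by rewrite mulr_gt0 ?divr_gt0// subr_gt0 -expR0 ltr_expR.
near=> n.
have [n0 _ L1 l21] : [/\ (0 < n)%N, 0 <= ln (n%:R : R), 1 <= ln (n%:R : R) &
  1 <= ln (ln (n%:R : R))] by near: n; exact: near_logs.
have L0 : 0 < ln (n%:R : R) by exact: lt_le_trans L1.
have rn0 : 0 < rho n by near: n.
pose y := ln n%:R - ln (ln (ln n%:R)) - D - eps.
have rhoE : rho n = Num.sqrt (2 * y) by [].
(* a positive radius rules out the default value of the square root *)
have y0 : 0 < y by move: rn0; rewrite rhoE sqrtr_gt0 pmulr_rgt0.
have sqrtL : expR (ln (ln n%:R) / 2) = Num.sqrt (ln (n%:R : R)).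
  by rewrite -powR12_sqrt ?(ltW L0)// /powR (gt_eqF L0) mulrC.
split.
- exact: ltW.
- rewrite sqrtL [leRHS]mulrDl mul1r; apply: lerD; last by rewrite -[leLHS]sqrtr1 ler_wsqrtr.
  rewrite mulrAC (ler_pM2r gi0) -sqrtrM; last by rewrite mulr_ge0.
  rewrite rhoE ler_wsqrtr// -mulrA ler_pM2l//.
  by apply: log_radius_le => //; exact: ln_ge0.
- rewrite /density_profile rhoE sqr_sqrtr ?mulr_ge0 ?(ltW y0)//.
  rewrite (_ : 2 * y / 2 = y); last by field.
  rewrite expected_cube_count//.
    rewrite expR_delta_gaussian//; lra.
  exact: lt_le_trans l21.
Unshelve. all: by end_near.
Qed.

(** Here [q = L - exp (- eps) l] is the denominator in the critical radius; each of
the [(n / L)^(d / alpha) = exp (d (L - l) / alpha)] cubes expects [(d / alpha) q]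
points, and the leading terms in [L] cancel. *)
Lemma grid_bound_power_law (alpha c eps : R) : 0 < alpha -> 0 < c -> 0 < eps ->
  let rho := critical_radius d (PowerLaw alpha) c eps in
  grid_bound d n (rho n) (density_profile (PowerLaw alpha) c (rho n))
    @[n --> \oo] --> (0 : R).
Proof.
move=> a0 c0 e0 rho.
pose D := delta d (PowerLaw alpha) c.
have DE : D = c * alpha * g ^+ d / d%:R by exact: delta_power_law.
have D0 : 0 < D by rewrite DE divr_gt0// !mulr_gt0// exprn_gt0.
have D2 : 0 <= 2 * D by rewrite pmulr_rge0// ltW.
have eps1 : expR (- eps) < 1 by rewrite -expR0 ltr_expR oppr_lt0.
apply: (grid_bound_cvg0 (e := fun n => (ln n%:R - ln (ln n%:R)) / alpha)
  (B := (2 * D) `^ alpha^-1 / g + 1)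
  (k := d%:R / alpha * (1 - expR (- eps))) d1).
  by rewrite mulr_gt0 ?divr_gt0// subr_gt0.
near=> n.
have [n0 LD L1 l21] : [/\ (0 < n)%N, 4 / D <= ln (n%:R : R),
  1 <= ln (n%:R : R) & 1 <= ln (ln (n%:R : R))] by near: n; exact: near_logs.
have n0' : 0 < n%:R :> R by rewrite ltr0n.
have nE : n%:R = expR (ln (n%:R : R)) by rewrite lnK.
have L0 : 0 < ln (n%:R : R) by exact: lt_le_trans L1.
have LE : ln (n%:R : R) = expR (ln (ln n%:R)) by rewrite lnK.
set L := ln n%:R in LD L1 l21 nE L0 LE *; set l := ln L in l21 LE *.
have l0 : 0 < l by exact: lt_le_trans l21.
pose q := L - expR (- eps) * l.
have el : 0 <= expR (- eps) * l <= l.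
  by rewrite mulr_ge0 ?expR_ge0 ?(ltW l0)//= ler_piMl ?(ltW l0) ?(ltW eps1).
have l2L : 2 * l <= L by rewrite LE; apply: expR_ge_double; exact: ltW.
have qL : L / 2 <= q <= L by rewrite /q; lra.
have q0 : 0 < q by lra.
have L2n : L * (L / 4) <= n%:R.
  rewrite nE; apply: le_trans (expR_ge_sqr (ltW L0)).
  rewrite expr2; nra.
(* the base of the power is nonnegative for large [n], because [n >= L^2 / 4] *)
have x1 : 1 <= D * n%:R / q.
  rewrite ler_pdivlMr// mul1r; apply: (@le_trans _ _ L); first lra.
  rewrite -ler_pdivrMl//; apply: le_trans L2n.
  rewrite mulrC ler_pM2l//; move: LD; rewrite ler_pdivrMr// => LD.
  by rewrite ler_pdivlMr// mulrC ler_pdivrMr// mulrC.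
have x0 : 0 <= D * n%:R / q - 1 by rewrite subr_ge0.
have rhoE : rho n = (D * n%:R / q - 1) `^ alpha^-1 by [].
have rhoa : 1 + rho n `^ alpha = D * n%:R / q.
  by rewrite rhoE -powRrM mulVf ?gt_eqF// powRr1// addrC subrK.
have nL : n%:R / L = expR (L - l) by rewrite expRD expRN -nE -LE.
split.
- exact: powR_ge0.
- have E1 : 1 <= expR ((L - l) / alpha).
    by rewrite -expR0 ler_expR divr_ge0 ?(ltW a0)//; lra.
  rewrite [leRHS]mulrDl mul1r; apply: lerD => //.
  rewrite mulrAC (ler_pM2r gi0) rhoE.
  have -> : expR ((L - l) / alpha) = expR (L - l) `^ alpha^-1.
    by rewrite /powR gt_eqF ?expR_gt0// expRK mulrC.
  rewrite -(powRM _ D2 (expR_ge0 _)).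
  apply: ge0_ler_powR; rewrite ?nnegrE ?invr_ge0 ?(ltW a0)//.
    exact: mulr_ge0 D2 (expR_ge0 _).
  apply: (@le_trans _ _ (D * n%:R / q)); first by rewrite gerBl.
  rewrite -nL ler_pdivrMr//.
  have -> : 2 * D * (n%:R / L) * q = D * n%:R * (q / (L / 2)).
    by field;  rewrite gt_eqF.
  apply: (ler_peMr (ltW (mulr_gt0 D0 n0'))).
  by rewrite ler_pdivlMr ?divr_gt0//; lra.
- rewrite /density_profile rhoa -/L -/l.
  have -> : n%:R * (c / (D * n%:R / q) * g ^+ d) = d%:R / alpha * q.
    rewrite DE; field.
    by rewrite !gt_eqF ?exprn_gt0.
  by rewrite le_eqVlt; apply/orP; left; apply/eqP; rewrite /q; field; rewrite gt_eqF.
Unshelve. all: by end_near.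
Qed.

Lemma critical_grid_bound_cvg0 (fam : density_family R) (c eps : R) :
  admissible_family d fam -> 0 < c -> 0 < eps ->
  let rho := critical_radius d fam c eps in
  (\forall n \near \oo, 0 < rho n) ->
  grid_bound d n (rho n) (density_profile fam c (rho n)) @[n --> \oo] --> (0 : R).
Proof.
case: fam => [alpha||] adm c0 e0 rho rho0.
- by apply: grid_bound_power_law => //; exact: lt_trans adm.
- exact: grid_bound_exponential.
- exact: grid_bound_gaussian.
Qed.

End critical.

Unset Implicit Arguments.

(** * Coverage below the critical radius *)

Theorem theorem2p1 (R : realType) (d : nat) (fam : density_family R) (c : R)
    (disp : measure_display) (T : measurableType disp) (P : probability T R)
    (X : nat -> {RV P >-> d.-tuple R}) (r : nat -> R) (eps : R) :
  (1 <= d)%N ->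
  admissible_family d fam ->
  normalization_constant d fam c ->
  iid_from X (model_density fam c) ->
  (forall n, (1 <= n)%N -> 0 < r n) ->
  (forall m n, (1 <= m)%N -> (m <= n)%N -> r m <= r n) ->
  0 < eps ->
  (\forall n \near \oo, r n <= critical_radius d fam c eps n) ->
  P (cover_event X n (r n)) @[n --> \oo] --> 1%E.
Proof.
move=> d1 adm [c0 _] iidX rpos rinc e0 near_r.
pose rho := critical_radius d fam c eps.
have rho0 : \forall n \near \oo, 0 < rho n.
  near=> n; apply: (@lt_le_trans _ _ (r n)); last by near: n.
  by apply: rpos; near: n; exact: nbhs_infty_ge.
apply: (coverage_probability_cvg1 d1 iidX (measurable_model_density fam c) rpos
  rinc (m0 := density_profile fam c 2^-1) (rho := rho)
  (m := fun n => density_profile fam c (rho n))).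
- exact: density_profile_gt0.
- by move=> x; exact: density_profile_le_model.
- near=> n; split; first by near: n.
  + exact/ltW/density_profile_gt0.
  + by move=> x; exact: density_profile_le_model.
- exact: critical_grid_bound_cvg0.
Unshelve. all: by end_near.
Qed.
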